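(* There exist absolute constants $C_1,C_2>0$ such that, for any $d\ge 3$ and $G\sim\mathcal{G}(n,d)$, the following hold: 1. With high probability, $C_1\frac{\log d}{d}\le \mathrm{dom}(G)\le C_2\frac{\log d}{d}$. 2. The trivial bound certifies $\mathrm{dom}(G)\ge\frac{1}{d+1}$ always; that is, $\mathrm{dom}(G)\ge \frac1{d+1}$ for every $d$-regular $G$. 3. If Conjecture L holds, then for any $\varepsilon>0$ there is no polynomial-time algorithm certifying $\mathrm{dom}(G)\ge\frac{1}{d+1}+\varepsilon$ with high probability.
   Context: $\mathrm{dom}(G)$ is the minimum size of a dominating set of $G$, divided by $|V(G)|$. A dominating set is a set $S$ such that every vertex outside $S$ is adjacent to a vertex of $S$. ''With high probability'' means with probability tending to $1$ as $n\to\infty$. Models: $\mathcal{G}(n,d)$ is the uniform distribution on simple $d$-regular graphs on $[n]$; $\mathcal{G}((\frac n2,\frac n2),d)$ is the uniform distribution on simple $d$-regular bipartite graphs with both sides of size $n/2$. For a $d$-regular multigraph $H$ on $k$ vertices (loops allowed, each loop contributing $1$ to the degree; adjacency matrix $M$ with $M_{ii}$ the number of loops at $i$), the random lift $\mathcal{L}_m(H)$ is the law of the graph on $km$ vertices split into fibers of size $m$ indexed by $V(H)$. For each non-loop edge $\{i,j\}$ of $H$, an independent uniformly random perfect matching between fibers $i$ and $j$ is inserted. For each loop at $i$, an independent uniformly random perfect matching within fiber $i$ is inserted ($m$ even when loops are present). The output is conditioned on being simple. Ramanujan conditions: $H$ is Ramanujan if $\max\{|\lambda_2(H)|,|\lambda_k(H)|\}\le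 2\sqrt{d-1}$. It is bipartite Ramanujan if it is bipartite and $\max\{|\lambda_2(H)|,|\lambda_{k-1}(H)|\}\le 2\sqrt{d-1}$. Here $\lambda_1\ge\dots$ are adjacency eigenvalues. Noise: for $d$-regular $G,G'$ on the same $n$ vertices, $\Delta(G,G')=|E(G)\triangle E(G')|/(2n)$. For $\epsilon\in(0,1)$ the noise models are: - $\mathcal{S}^{\mathrm{rand}}_\epsilon$ deletes $\lfloor\epsilon n\rfloor$ uniformly random edges, then adds $\lfloor\epsilon n\rfloor$ uniformly random edges conditioned on the result being $d$-regular. - $\mathcal{S}^{\mathrm{rand,bi}}_\epsilon$ is the same, except the added edges go across the bipartition. - The respectful versions $\widetilde{\mathcal{S}}^{\mathrm{rand}}_\epsilon,\widetilde{\mathcal{S}}^{\mathrm{rand,bi}}_\epsilon$, applied to $G\sim\mathcal{L}_m(H)$, additionally condition on no added edge joining the fibers of $i,j$ with $M_{ij}=0$. - Adversarial noise $\mathcal{S}^{\mathrm{adv}}_\epsilon\mathcal{L}_m(H)$ is any distribution obtained by sampling $G\sim\mathcal{L}_m(H)$ and letting an adversary (with extra randomness) output a $d$-regular $G'$ with $\Delta(G,G')\le\epsilon$. The respectful adversarial version $\widetilde{\mathcal{S}}^{\mathrm{adv}}_\epsilon$ additionally forbids adding edges between fibers of $i,j$ with $M_{ij}=0$. - ''Hard under adversarial noise'' means some choice of adversary makes it hard. An algorithm achieves strong detection between $\mathbb{P}_n$ and $\mathbb{Q}_n$ if both of its error probabilities tend to $0$. Conjecture L: for every $d$-regular Ramanujan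 multigraph $H$ on $k$ vertices and every $\epsilon>0$, no polynomial-time algorithm achieves strong detection between $\mathcal{S}_\epsilon\mathcal{L}_m(H)$ and $\mathcal{G}(km,d)$ as $m\to\infty$, for each $\mathcal{S}_\epsilon\in\{\mathcal{S}^{\mathrm{rand}}_\epsilon,\widetilde{\mathcal{S}}^{\mathrm{rand}}_\epsilon,\mathcal{S}^{\mathrm{adv}}_\epsilon,\widetilde{\mathcal{S}}^{\mathrm{adv}}_\epsilon\}$. Likewise, for every $d$-regular bipartite Ramanujan $H$ and $\epsilon>0$, none exists between $\mathcal{S}_\epsilon\mathcal{L}_m(H)$ and $\mathcal{G}((\frac{km}2,\frac{km}2),d)$, for each $\mathcal{S}_\epsilon\in\{\mathcal{S}^{\mathrm{rand,bi}}_\epsilon,\widetilde{\mathcal{S}}^{\mathrm{rand,bi}}_\epsilon,\mathcal{S}^{\mathrm{adv}}_\epsilon,\widetilde{\mathcal{S}}^{\mathrm{adv}}_\epsilon\}$. Certification: an algorithm with output $c(G)$ certifies a lower bound on $f$ if $f(G)\ge c(G)$ for every input $d$-regular $G$. It certifies $f(G)\ge B$ with high probability if moreover $\Pr[c(G)\ge B]\to1$ as $n\to\infty$. *)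

(* Defs.v *)
From mathcomp Require Import all_boot all_order all_fingroup all_algebra.
From mathcomp Require Import classical_sets reals topology normedtype exp.

Set Implicit Arguments.
Unset Strict Implicit.
Unset Printing Implicit Defensive.

Import Order.TTheory GRing.Theory Num.Theory.
Import numFieldNormedType.Exports.

Local Open Scope ring_scope.

(** * Finite distributions, as mass functions *)

Section Dist.
Variable R : realType.

Definition is_dist (T : finType) (p : {ffun T -> R}) : Prop :=
  (forall x, 0 <= p x) /\ \sum_x p x = 1.

(* The zero function when A is empty. *)
Definition unif (T : finType) (A : {set T}) : {ffun T -> R} :=
  [ffun x => (x \in A)%:R / #|A|%:R].

Definition bind (T U : finType) (p : {ffun T -> R}) (K : T -> {ffun U -> R}) :
    {ffun U -> R} :=
  [ffun y => \sum_x p x * K x y].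

Definition point_mass (T : finType) (x : T) : {ffun T -> R} :=
  [ffun y => (y == x)%:R].

Definition Pr (T : finType) (p : {ffun T -> R}) (A : pred T) : R :=
  \sum_(x | A x) p x.

(* Limit as n tends to infinity through the n satisfying [adm]. *)
Definition tends_along (adm : pred nat) (u : nat -> R) (l : R) : Prop :=
  (u n @[n --> within (fun n => adm n) \oo] --> l)%classic.

End Dist.

(** * Polynomial time *)

(* Deterministic Turing machines with one two-way infinite work tape, initially
   holding the input, and a one-way write-only output tape.  [None] is the blank
   tape symbol; a transition [None] halts. *)
Variant move := MoveLeft | MoveRight | Stay.

Record machine := Machine {
  state : finType;
  aux : finType;
  start : state;
  delta : state -> option (bool + aux) ->
          option (state * option (bool + aux) * move * option bool)
}.

Section Run.
Variable M : machine.

(* State, tape to the left of the head (nearest cell first), tape from the head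
   on, output so far. *)
Definition config : Type :=
  state M * seq (option (bool + aux M)) * seq (option (bool + aux M)) * seq bool.

Definition init (x : seq bool) : config :=
  (start M, [::], [seq Some (inl b) | b <- x], [::]).

Definition step (c : config) : option config :=
  let: (q, l, r, w) := c in
  if delta q (head None r) is Some (q', a, mv, o) then
    let w' := if o is Some b then rcons w b else w in
    Some (match mv with
          | MoveLeft => (q', behead l, head None l :: a :: behead r, w')
          | MoveRight => (q', a :: l, behead r, w')
          | Stay => (q', l, a :: behead r, w')
          end)
  else None.

(* The output, if the machine halts within t steps. *)
Fixpoint run (t : nat) (c : config) : option (seq bool) :=
  if step c is Some c' then
    if t is t'.+1 then run t' c' else None
  else Some c.2.

End Run.

Definition polytime (f : seq bool -> seq bool) : Prop :=
  exists (M : machine) (c e : nat), forall x : seq bool,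
    run (c * size x ^ e + c)%N (init M x) = Some (f x).

(* A word s a_0 b_0 a_1 b_1 ... stands for (-1)^s * a / b, where a and b have
   binary digits (a_i) and (b_i), least significant first. *)
Fixpoint numer (w : seq bool) : nat :=
  if w is a :: _ :: w' then (a + (numer w').*2)%N else 0%N.

Fixpoint denom (w : seq bool) : nat :=
  if w is _ :: b :: w' then (b + (denom w').*2)%N else 0%N.

Definition rat_of_word (w : seq bool) : rat :=
  if w is s :: w' then (-1) ^+ s * ((numer w')%:R / (denom w')%:R) else 0.

(** * Simple graphs on [n], as sets of edges *)

Notation graph n := {set {set 'I_n}}.

Section Graphs.
Variable n : nat.
Implicit Types (E F A : graph n) (S : {set 'I_n}).

Definition regular (d : nat) E : bool :=
  [forall e in E, #|e| == 2] && [forall v, #|[set e in E | v \in e]| == d].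

Definition bipartite E : bool :=
  [exists S : {set 'I_n},
    (#|S|.*2 == n) && [forall e in E, #|e :&: S| == 1%N]].

Definition dominating E S : bool :=
  [forall v, (v \notin S) ==> [exists u in S, [set u; v] \in E]].

Definition dom_ratio (R : realType) E : R :=
  #|[arg min_(S < [set: 'I_n] | dominating E S) #|S|]|%:R / n%:R.

(* Row-major adjacency matrix. *)
Definition encode E : seq bool :=
  [seq [set u; v] \in E | u <- enum 'I_n, v <- enum 'I_n].

Definition edge_dist (R : realType) E F : R :=
  #|(E :\: F) :|: (F :\: E)|%:R / (2 * n%:R).

End Graphs.

Definition random_regular (R : realType) (d n : nat) : {ffun graph n -> R} :=
  unif R [set E : graph n | regular d E].

Definition random_bip_regular (R : realType) (d n : nat) : {ffun graph n -> R} :=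
  unif R [set E : graph n | regular d E && bipartite E].

(** * Base multigraphs, given by their adjacency matrix *)

Section Multigraphs.
Variables (k : nat) (M : 'M[nat]_k).

Definition regular_multigraph (d : nat) : Prop :=
  (forall i j, M i j = M j i) /\ (forall i, (\sum_j M i j)%N = d).

Definition has_loop : bool := [exists i, M i i != 0%N].

Definition bipartition (side : 'I_k -> bool) : Prop :=
  forall i j, M i j != 0%N -> side i != side j.

(* The eigenvalues with multiplicity, in nonincreasing order: lambda_i is
   s`_(i - 1). *)
Definition spectrum (R : realType) (s : seq R) : Prop :=
  sorted >=%R s /\
  char_poly (map_mx (fun a : nat => a%:R : R) M) = \prod_(x <- s) ('X - x%:P).

Definition ramanujan (R : realType) (d : nat) : Prop :=
  (1 < k)%N /\
  exists s : seq R, spectrum s /\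
    Num.max `|s`_1| `|s`_k.-1| <= 2 * Num.sqrt (d%:R - 1).

Definition bip_ramanujan (R : realType) (d : nat) : Prop :=
  [/\ (1 < k)%N,
      exists side, bipartition side
    & exists s : seq R, spectrum s /\
        Num.max `|s`_1| `|s`_k.-2| <= 2 * Num.sqrt (d%:R - 1)].

End Multigraphs.

(** * Random lifts *)

(* A labelling of the vertices [km] by pairs (fiber, position in the fiber), and
   a permutation for each triple (i, j, c).  For i < j and c < M i j the
   permutation of (i, j, c) is the matching over the c-th edge joining i and j;
   for c < M i i that of (i, i, c) is the matching over the c-th loop at i.  The
   other permutations are not used.  The labelling is random: were the fibers
   fixed, a lift would be told apart from a random regular graph at sight. *)
Notation lift_sample k m d :=
  ({ffun 'I_(k * m) -> 'I_k * 'I_m} * {ffun 'I_k * 'I_k * 'I_d -> 'S_m})%type.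

Section Lifts.
Variables (k : nat) (M : 'M[nat]_k) (d m : nat).
Implicit Types (w : lift_sample k m d) (c : 'I_d) (u v : 'I_(k * m)).

Definition fiber w u : 'I_k := (w.1 u).1.

Definition lift_arc w c u v : bool :=
  let: (i, a) := w.1 u in
  let: (j, b) := w.1 v in
  [&& (i <= j)%N, (c < M i j)%N & w.2 (i, j, c) a == b].

Definition lift_graph w : graph (k * m) :=
  [set e | [exists u, exists v, (e == [set u; v]) && [exists c, lift_arc w c u v]]].

Definition loops_matched w : bool :=
  [forall i, forall c : 'I_d, (c < M i i)%N ==>
    [forall a, (w.2 (i, i, c) a != a) &&
               (w.2 (i, i, c) (w.2 (i, i, c) a) == a)]].

(* Loops are already excluded by [loops_matched]. *)
Definition no_parallel w : bool :=
  [forall u, forall v, forall c, forall c',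
    lift_arc w c u v && lift_arc w c' u v ==> (c == c')].

Definition lifts : {set lift_sample k m d} :=
  [set w : lift_sample k m d |
    [&& injectiveb w.1, loops_matched w & no_parallel w]].

Definition respectful w (e : {set 'I_(k * m)}) : bool :=
  [forall u in e, forall v in e,
    (u != v) ==> (M (fiber w u) (fiber w v) != 0%N)].

Definition crossing (side : 'I_k -> bool) w (e : {set 'I_(k * m)}) : bool :=
  [forall u in e, forall v in e,
    (u != v) ==> (side (fiber w u) != side (fiber w v))].

End Lifts.

(** * Noise *)

Section RandomNoise.
Variables (R : realType) (n d : nat) (eps : R) (allowed : pred {set 'I_n}).

Definition deletions (E : graph n) : {set graph n} :=
  [set F : graph n | (F \subset E) && (#|F| == Num.truncn (eps * n%:R))].

Definition additions (E : graph n) : {set graph n} :=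
  [set A : graph n | [&& [disjoint A & E],
                         #|A| == Num.truncn (eps * n%:R),
                         [forall e in A, allowed e] & regular d (E :|: A)]].

Definition rand_noise (E : graph n) : {ffun graph n -> R} :=
  bind (unif R (deletions E)) (fun F =>
    bind (unif R (additions (E :\: F))) (fun A => point_mass R ((E :\: F) :|: A))).

End RandomNoise.

Section Hardness.
Variables (R : realType) (k : nat) (M : 'M[nat]_k) (d : nat).

Definition noise : Type :=
  forall m : nat, lift_sample k m d -> {ffun graph (k * m) -> R}.

Definition srand (eps : R) : noise := fun m w =>
  rand_noise d eps xpredT (lift_graph M w).

Definition srand_resp (eps : R) : noise := fun m w =>
  rand_noise d eps (respectful M w) (lift_graph M w).

Definition srand_bi (side : 'I_k -> bool) (eps : R) : noise := fun m w =>
  rand_noise d eps (crossing side w) (lift_graph M w).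

Definition srand_bi_resp (side : 'I_k -> bool) (eps : R) : noise := fun m w =>
  rand_noise d eps (fun e => crossing side w e && respectful M w e)
    (lift_graph M w).

Definition adversary (eps : R) (K : noise) : Prop :=
  forall (m : nat) (w : lift_sample k m d), w \in lifts M d m ->
    is_dist (K m w) /\
    forall E', K m w E' != 0 ->
      regular d E' /\ edge_dist R (lift_graph M w) E' <= eps.

Definition adversary_resp (eps : R) (K : noise) : Prop :=
  adversary eps K /\
  forall (m : nat) (w : lift_sample k m d), w \in lifts M d m ->
    forall E', K m w E' != 0 ->
      [forall e in E' :\: lift_graph M w, respectful M w e].

Definition noisy_lift (K : noise) (m : nat) : {ffun graph (k * m) -> R} :=
  bind (unif R (lifts M d m)) (K m).

(* The answer [:: true] stands for "P", every other answer for "Q". *)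
Definition strong_detection (P Q : forall m, {ffun graph (k * m) -> R})
    (f : seq bool -> seq bool) : Prop :=
  let adm := fun m => has_loop M ==> ~~ odd m in
  tends_along adm (fun m => Pr (P m) (fun E => f (encode E) != [:: true])) 0 /\
  tends_along adm (fun m => Pr (Q m) (fun E => f (encode E) == [:: true])) 0.

Definition hard (Q : forall m, {ffun graph (k * m) -> R}) (K : noise) : Prop :=
  forall f, polytime f -> ~ strong_detection (noisy_lift K) Q f.

End Hardness.

Arguments srand {R k} M d eps.
Arguments srand_resp {R k} M d eps.
Arguments srand_bi {R k} M d side eps.
Arguments srand_bi_resp {R k} M d side eps.

(* Only for d >= 3: for d = 2 the 6-cycle satisfies the Ramanujan inequality,
   yet its lifts stay bipartite under respectful noise. *)
Definition conjecture_L (R : realType) : Prop :=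
  forall (d k : nat) (M : 'M[nat]_k) (eps : R),
    (3 <= d)%N -> regular_multigraph M d -> 0 < eps < 1 ->
    (ramanujan M R d ->
      let Q := fun m => random_regular R d (k * m) in
      [/\ hard M Q (srand M d eps),
          hard M Q (srand_resp M d eps),
          exists2 K : noise R k d, adversary M eps K & hard M Q K
        & exists2 K : noise R k d, adversary_resp M eps K & hard M Q K]) /\
    (bip_ramanujan M R d ->
      let Q := fun m => random_bip_regular R d (k * m) in
      [/\ forall side, bipartition M side -> hard M Q (srand_bi M d side eps),
          forall side, bipartition M side ->
            hard M Q (srand_bi_resp M d side eps),
          exists2 K : noise R k d, adversary M eps K & hard M Q K
        & exists2 K : noise R k d, adversary_resp M eps K & hard M Q K]).

(** * Certification *)

(* d-regular graphs on n vertices exist only for even d * n. *)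
Definition whp (R : realType) (d : nat) (A : forall n, pred (graph n)) : Prop :=
  tends_along (fun n => ~~ odd (d * n)) (fun n => Pr (random_regular R d n) (A n)) 1.

Definition certifies_lower (R : realType) (d : nat) (f : forall n, graph n -> R)
    (alg : seq bool -> seq bool) : Prop :=
  forall (n : nat) (E : graph n), (0 < n)%N -> regular d E ->
    ratr (rat_of_word (alg (encode E))) <= f n E.

Definition certifies_whp (R : realType) (d : nat) (f : forall n, graph n -> R)
    (B : R) (alg : seq bool -> seq bool) : Prop :=
  certifies_lower d f alg /\
  whp R d (fun n E => B <= ratr (rat_of_word (alg (encode E)))).

(* Main.v *)
Require Import Defs.
From mathcomp Require Import classical_sets reals topology normedtype exp sequences.
From mathcomp Require Import all_boot all_order all_fingroup all_algebra.
From mathcomp Require Import zify ring lra.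

Set Implicit Arguments.
Unset Strict Implicit.
Unset Printing Implicit Defensive.

Import Order.TTheory GRing.Theory Num.Theory.
Import numFieldNormedType.Exports.
Local Open Scope ring_scope.

(** The upper bound on dom(G) holds for every d-regular graph: a greedily chosen
    vertex dominates at least a (d+1)/n proportion of the undominated vertices.

    For the lower bound fix a set S of s vertices and reveal the vertices outside S
    one by one.  A switching that replaces the edges vu, ab by va, ub, where u is in S
    and v, a, b are not, lowers the number of neighbours of v in S by one and keeps
    every other dominated vertex dominated.  Counting these switchings both ways
    compares the numbers of graphs in which v has j + 1 and j neighbours in S; whatever
    is assumed on the domination of the other vertices, v is thus undominated with
    probability at least (1 + beta)^(-d), where beta is about s / n.  Hence S dominates
    with probability at most (1 - (1 + beta)^(-d))^(n - s), and a union bound over S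
    concludes.

    For the hardness take H = K_(d+1), whose nontrivial eigenvalues are all -1.  A
    fiber of a lift of H is a dominating set, and each edge deleted by the adversary
    costs at most one more vertex, so that every noisy lift has domination ratio close
    to 1/(d+1).  Comparing a certified bound with a rational threshold would therefore
    tell lifts from random regular graphs.  The comparison reads the digits from the
    least significant one with a bounded carry, so a finite automaton fed with the
    output of the certification machine performs it. *)

(** * Domination in regular graphs *)

Section Neighbourhoods.
Variable n : nat.
Implicit Types (E : graph n) (S U : {set 'I_n}) (u v w : 'I_n).

Definition nbrs E u : {set 'I_n} := [set v | [set u; v] \in E].

Definition dominated E S v : bool := [exists u in S, [set u; v] \in E].

Lemma eq_set2 u v x y :
  ([set u; v] == [set x; y]) = (u == x) && (v == y) || (u == y) && (v == x).
Proof.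
apply/eqP/orP => [eq_uv|[]/andP[/eqP-> /eqP->]//]; last by rewrite setUC.
have := set21 u v; have := set22 u v; rewrite eq_uv !inE.
have := set21 x y; have := set22 x y; rewrite -eq_uv !inE.
move=> /orP[]/eqP-> /orP[]/eqP-> /orP[]/eqP e1 /orP[]/eqP e2;
  by rewrite ?e1 ?e2 !eqxx ?orbT; auto.
Qed.

Lemma set2_inj u : injective (fun v => [set u; v]).
Proof.
move=> v w /= /eqP; rewrite eq_set2 eqxx /= => /orP[/eqP//|/andP[/eqP-> /eqP->]//].
Qed.

Lemma in_nbrs E u v : (v \in nbrs E u) = ([set u; v] \in E).
Proof. by rewrite inE. Qed.

Lemma nbrsC E u v : (v \in nbrs E u) = (u \in nbrs E v).
Proof. by rewrite !in_nbrs setUC. Qed.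

Lemma regular_edge d E e : regular d E -> e \in E -> #|e| = 2%N.
Proof. by move=> /andP[/forall_inP cE _] /cE/eqP. Qed.

Lemma regular_irr d E u : regular d E -> (u \in nbrs E u) = false.
Proof.
move=> rE; apply/negP; rewrite in_nbrs => /(regular_edge rE).
by rewrite setUid cards1.
Qed.

Lemma card_nbrs d E u : regular d E -> #|nbrs E u| = d.
Proof.
move=> rE; have /andP[_ /forallP/(_ u)/eqP<-] := rE.
rewrite -(card_imset _ (@set2_inj u)); apply: eq_card => e.
rewrite [RHS]inE; apply/imsetP/idP => [[v]|/andP[eE ue]].
  by rewrite in_nbrs => uvE ->; rewrite uvE set21.
have /eqP/cards2P[x [y [xy eq_e]]] := regular_edge rE eE.
move: ue eE; rewrite eq_e !inE => /orP[]/eqP-> xyE.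
  by exists y; rewrite // in_nbrs.
by exists x; rewrite // ?in_nbrs setUC.
Qed.

Lemma dominatedP E S v :
  reflect (exists2 u, u \in S & u \in nbrs E v) (dominated E S v).
Proof.
apply: (iffP exists_inP) => -[u uS uvE]; exists u => //.
  by rewrite in_nbrs setUC.
by rewrite setUC -in_nbrs.
Qed.

Lemma dominatingP E S :
  reflect (forall v, v \notin S -> dominated E S v) (dominating E S).
Proof. by apply: (iffP forallP) => H v; apply/implyP; apply: H. Qed.

Lemma dominatingS E S U : S \subset U -> dominating E S -> dominating E U.
Proof.
move=> /subsetP SU /dominatingP dS; apply/dominatingP => v vU.
have /dS/dominatedP[u uS uv] : v \notin S by apply: contra vU; apply: SU.
by apply/dominatedP; exists u => //; apply: SU.
Qed.

(** The neighbourhoods of the members of [S], of size [d] each, cover the complement of [S]. *)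
Lemma leq_dominating d E S :
  regular d E -> dominating E S -> (n <= d.+1 * #|S|)%N.
Proof.
move=> rE /dominatingP dS.
have sub : ~: S \subset \bigcup_(u in S) nbrs E u.
  apply/subsetP => v; rewrite inE => /dS/dominatedP[u uS uv].
  by apply/bigcupP; exists u => //; rewrite nbrsC.
have : (#|\bigcup_(u in S) nbrs E u| <= d * #|S|)%N.
  rewrite mulnC -sum_nat_const; elim/big_rec2: _ => [|u k A uS le_Ak].
    by rewrite cards0.
  by rewrite cardsU (card_nbrs u rE) (leq_trans (leq_subr _ _)) // leq_add2l.
have := subset_leq_card sub.
by have := cardsC S; rewrite card_ord; lia.
Qed.

Definition undominated E S : {set 'I_n} :=
  [set v | (v \notin S) && ~~ dominated E S v].

Lemma dominating_undominated E S : dominating E (S :|: undominated E S).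
Proof.
apply/dominatingP => v; rewrite !inE negb_or => /andP[vS].
rewrite vS /= negbK => /dominatedP[u uS uv].
by apply/dominatedP; exists u; rewrite // inE uS.
Qed.

(** * The domination ratio: trivial lower bound and greedy upper bound *)

Section Ratio.
Variable R : realType.

Lemma dom_ratio_le E S :
  dominating E S -> dom_ratio R E <= #|S|%:R / n%:R.
Proof.
move=> dS; rewrite /dom_ratio; case: arg_minnP => [|U dU minU].
  by apply/dominatingP => v; rewrite inE.
by rewrite ler_wpM2r ?invr_ge0 // ler_nat minU.
Qed.

Lemma dom_ratio_ex E :
  exists2 S, dominating E S & dom_ratio R E = #|S|%:R / n%:R.
Proof.
rewrite /dom_ratio; case: arg_minnP => [|U dU minU]; last by exists U.
by apply/dominatingP => v; rewrite inE.
Qed.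

Lemma dom_ratio_ge d E : (0 < n)%N -> regular d E ->
  1 / d.+1%:R <= dom_ratio R E.
Proof.
move=> n0 rE; have [S dS ->] := dom_ratio_ex E.
rewrite ler_pdivrMr ?ltr0Sn // mulrAC ler_pdivlMr ?ltr0n // mul1r -natrM ler_nat.
by rewrite mulnC (leq_dominating rE).
Qed.

(** Each undominated vertex lies in [d.+1] closed neighbourhoods [cn v], so on average over [v] the
    set [cn v] contains [d.+1 * #|U| / n] of them; a [v] reaching the average is added. Multiplying
    by [n] keeps the inequality in the naturals. *)
Lemma greedy_step d E S : regular d E -> (0 < n)%N ->
  exists v, (n * #|undominated E (v |: S)| + d.+1 * #|undominated E S|
             <= n * #|undominated E S|)%N.
Proof.
move=> rE n0; set U := undominated E S.
pose cn v := v |: nbrs E v.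
have cnC u v : (u \in cn v) = (v \in cn u).
  by rewrite !inE eq_sym -!in_nbrs nbrsC.
have dc : (\sum_v #|cn v :&: U| = d.+1 * #|U|)%N.
  under eq_bigr do rewrite -sum1_card big_mkcond /=.
  rewrite exchange_big /= mulnC -sum_nat_const [RHS]big_mkcond /=.
  apply: eq_bigr => x _; case: ifP => xU; last first.
    by apply: big1 => v _; rewrite in_setI xU andbF.
  under eq_bigr do rewrite in_setI xU andbT cnC.
  rewrite -big_mkcond sum1_card cardsU1 (regular_irr _ rE).
  by rewrite (card_nbrs x rE).
have [v vP] : exists v, (d.+1 * #|U| <= n * #|cn v :&: U|)%N.
  apply/existsP/contraT; rewrite negb_exists => /forallP small.
  have : (\sum_(v : 'I_n) (n * #|cn v :&: U|).+1 <= \sum_(v : 'I_n) d.+1 * #|U|)%N.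
    by apply: leq_sum => v _; rewrite ltnNge.
  under eq_bigr do rewrite -add1n.
  by rewrite big_split /= -big_distrr /= dc !sum_nat_const card_ord muln1
    -[X in (_ <= X)%N]add0n leq_add2r leqNgt n0.
exists v; set U' := undominated E _.
have sub : U' \subset U :\: cn v.
  apply/subsetP => x; rewrite !inE => /andP[/norP[xv xS] xU].
  have dxS u : u \in v |: S -> u \in nbrs E x = false.
    by move=> uS; apply: contraNF xU => ux; apply/dominatedP; exists u.
  rewrite negb_or xv xS -in_nbrs nbrsC (dxS v) ?setU11 //=.
  by apply: contra xU => /dominatedP[u uS ux]; rewrite dxS ?setU1r in ux.
have eqU : (n * #|U| = n * #|cn v :&: U| + n * #|U :\: cn v|)%N.
  by rewrite -mulnDr [cn v :&: U]setIC cardsID.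
have leU : (n * #|U'| <= n * #|U :\: cn v|)%N.
  by rewrite leq_mul2l subset_leq_card // orbT.
by move: vP leU eqU; lia.
Qed.

(** Each greedy step multiplies the undominated count by at most [1 - d.+1/n], hence by at most
    [expR (- (d.+1/n))]. *)
Lemma greedy_iter d E t : regular d E -> (0 < n)%N ->
  exists2 S : {set 'I_n}, (#|S| <= t)%N &
    #|undominated E S|%:R <= n%:R * expR (- (t%:R * (d.+1%:R / n%:R))) :> R.
Proof.
move=> rE n0; elim: t => [|t [S St leU]].
  exists set0; rewrite ?cards0 // mul0r oppr0 expR0 mulr1 ler_nat.
  by rewrite -[X in (_ <= X)%N]card_ord max_card.
have [v] := greedy_step S rE n0.
set U := undominated E S in leU *; set U' := undominated E _ => leU'.
exists (v |: S); first by rewrite cardsU1; case: (v \notin S); lia.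
rewrite -natr1 mulrDl mul1r opprD expRD mulrA.
apply: le_trans (ler_wpM2r (expR_ge0 _) leU).
apply: le_trans (_ : #|U|%:R * (1 - d.+1%:R / n%:R) <= _); last first.
  by rewrite ler_wpM2l // expR_ge1Dx.
have n0' : 0 < n%:R :> R by rewrite ltr0n.
rewrite -(ler_pM2l n0') mulrCA mulrBr mulr1 mulrCA divff ?gt_eqF // mulr1 mulrBr.
by rewrite lerBrDr -!natrM -natrD ler_nat ![(#|U| * _)%N]mulnC.
Qed.

(** About [n ln d / (d+1)] greedy steps leave at most [n/d] vertices undominated, and these are then
    added to the set. *)
Lemma dom_ratio_le_ln d E : (3 <= d)%N -> (d <= n)%N -> regular d E ->
  dom_ratio R E <= 5 * (ln d%:R / d%:R).
Proof.
move=> d3 dn rE; have n0 : (0 < n)%N by lia.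
have n0' : 0 < n%:R :> R by rewrite ltr0n.
have d0 : 0 < d%:R :> R by rewrite ltr0n; lia.
have d30 : 3 <= d%:R :> R by rewrite ler_nat.
have dn' : d%:R <= n%:R :> R by rewrite ler_nat.
have dn0 : 0 < d.+1%:R :> R by rewrite ltr0n.
(* From [ln d >= 1 - 1/d]. It lets the rounding term 1, at most [n/d], and the leftover [n/d] be
   absorbed into a multiple of [(n/d) ln d]. *)
have lnd : 2 / 3 <= ln d%:R :> R.
  have h : - ln d%:R <= d%:R^-1 - 1 :> R.
    rewrite -lnV ?posrE // -{1}[d%:R^-1](subrK 1) addrC le_ln1Dx //.
    by rewrite ltrBrDl subrr invr_gt0.
  have dV : d%:R^-1 <= 1 / 3 :> R by rewrite ler_pdivlMr // mulrC ler_pdivrMr //; lra.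
  have : 0 < d%:R^-1 :> R by rewrite invr_gt0.
  by lra.
pose t := (Num.truncn (n%:R * ln d%:R / d.+1%:R : R)).+1.
have [S St leU] := greedy_iter t rE n0.
have t_gt : n%:R * ln d%:R / d.+1%:R <= t%:R :> R by rewrite ltW // truncnS_gt.
have t_le : t%:R <= n%:R * ln d%:R / d.+1%:R + 1 :> R.
  by rewrite /t -natr1 lerD2r truncn_le !mulr_ge0 ?invr_ge0 //; lra.
have leU' : #|undominated E S|%:R <= n%:R / d%:R :> R.
  apply: le_trans leU _; rewrite ler_wpM2l //.
  rewrite -[d%:R^-1]lnK ?posrE ?invr_gt0 // ler_expR lnV ?posrE // lerN2.
  by rewrite mulrA ler_pdivlMr // -ler_pdivrMr // [ln _ * _]mulrC.
apply: le_trans (dom_ratio_le (dominating_undominated E S)) _; rewrite ler_pdivrMr //.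
have : #|S :|: undominated E S|%:R <= t%:R + n%:R / d%:R :> R.
  apply: le_trans (_ : #|S|%:R + #|undominated E S|%:R <= _).
    by rewrite -natrD ler_nat cardsU leq_subr.
  by rewrite lerD // ler_nat.
move/le_trans; apply.
have : n%:R * ln d%:R / d.+1%:R <= n%:R * ln d%:R / d%:R :> R.
  rewrite ler_wpM2l ?mulr_ge0 //; first by lra.
  by rewrite lef_pV2 ?posrE // ler_nat.
have : 1 <= n%:R / d%:R :> R by rewrite ler_pdivlMr // mul1r.
have : n%:R / d%:R * (2 / 3) <= n%:R / d%:R * ln d%:R :> R.
  by rewrite ler_wpM2l // divr_ge0.
have -> : 5 * (ln d%:R / d%:R) * n%:R = 5 * (n%:R / d%:R * ln d%:R) :> R by ring.
rewrite [n%:R * ln d%:R / d%:R]mulrAC.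
move: t_le; set x := n%:R * ln d%:R / d.+1%:R; set y := n%:R / d%:R * ln d%:R.
by set z := n%:R / d%:R; move: x y z (t%:R) => x y z t'; lra.
Qed.
End Ratio.
End Neighbourhoods.

(** * Switchings *)

Lemma card_dep_pairs (T U : finType) (A : {set T}) (B : T -> {set U}) :
  #|[set p : T * U | (p.1 \in A) && (p.2 \in B p.1)]| = (\sum_(x in A) #|B x|)%N.
Proof.
rewrite -sum1_card (eq_bigl (fun p => (p.1 \in A) && (p.2 \in B p.1))); last first.
  by move=> p; rewrite inE.
rewrite -(pair_big_dep (fun x => x \in A) (fun x y => y \in B x) (fun _ _ => 1%N)) /=.
by apply: eq_bigr => x _; rewrite sum1_card.
Qed.

Section Switch.
Variable n : nat.
Implicit Types (E : graph n) (S T : {set 'I_n}) (u v w a b x : 'I_n).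

Lemma card_arcs d E T : regular d E ->
  #|[set p : 'I_n * 'I_n | (p.1 \in T) && (p.2 \in nbrs E p.1)]| = (#|T| * d)%N.
Proof.
move=> rE; rewrite card_dep_pairs -sum_nat_const.
by apply: eq_bigr => u _; rewrite (card_nbrs u rE).
Qed.

Lemma card_arcs_to d E T : regular d E ->
  #|[set p : 'I_n * 'I_n | (p.2 \in T) && (p.2 \in nbrs E p.1)]| = (#|T| * d)%N.
Proof.
move=> rE; rewrite -(card_arcs T rE).
have swapK : involutive (fun p : 'I_n * 'I_n => (p.2, p.1)) by case.
rewrite -(card_imset _ (inv_inj swapK)); apply: eq_card => -[x y].
rewrite [RHS]inE /= nbrsC; apply/imsetP/idP => [[[y' x']]|xy].
  by rewrite inE /= => xy [-> ->].
by exists (y, x); rewrite // inE.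
Qed.

Definition switch E v u a b : graph n :=
  [set v; a] |: ([set u; b] |: E :\ [set v; u] :\ [set a; b]).

Definition switchable E v u a b : bool :=
  [&& [set v; u] \in E, [set a; b] \in E, [set v; a] \notin E,
      [set u; b] \notin E & uniq [:: v; u; a; b]].

(** The reverse switching exchanges the roles of [u] and [a]; hence switching along a fixed triple
    is injective. *)
Lemma switchK E v u a b :
  switchable E v u a b -> switch (switch E v u a b) v a u b = E.
Proof.
case/and5P=> vuE abE vaE ubE; rewrite /= !inE !negb_or -!andbA.
case/and5P=> vu va vb ua /and3P[ub ab _].
have [vu' va' ua'] : [/\ u != v, a != v & a != u] by split; rewrite eq_sym.
rewrite /switch setU1K ?setU1K.
- rewrite setD1K ?setD1K // !inE abE andbT eq_set2.
  by rewrite (negbTE va') (negbTE ua').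
- by rewrite !inE (negbTE ubE) !andbF.
- by rewrite !inE (negbTE vaE) !andbF eq_set2 (negbTE vu) (negbTE vb).
Qed.

(** Each of the four vertices loses one edge and gains one. *)
Lemma regular_switch d E v u a b :
  switchable E v u a b -> regular d E -> regular d (switch E v u a b).
Proof.
case/and5P=> vuE abE vaE ubE; rewrite /= !inE !negb_or -!andbA.
case/and5P=> vu va vb ua /and3P[ub ab _].
have [vu' va' ua'] : [/\ u != v, a != v & a != u] by split; rewrite eq_sym.
move=> /andP[/forall_inP cE /forallP degE].
apply/andP; split.
  apply/forall_inP => e; rewrite !inE => /or3P[/eqP->|/eqP->|/and3P[_ _ /cE//]].
    by rewrite cards2 va.
  by rewrite cards2 ub.
have degS (A : graph n) w : #|[set e in A | w \in e]| = (\sum_(e in A) (w \in e))%N.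
  rewrite -sum1_card (eq_bigl (fun e => (e \in A) && (w \in e))) => [|e].
    by rewrite big_mkcondr; apply: eq_bigr => e _; case: ifP.
  by rewrite inE.
apply/forallP => w; have /eqP := degE w; rewrite !degS => <-.
rewrite [X in _ == X](big_setD1 _ vuE) /=.
rewrite [X in _ == (_ + X)%N](big_setD1 [set a; b]) /=; last first.
  by rewrite !inE abE andbT eq_set2 (negbTE va') (negbTE ua').
rewrite big_setU1 ?big_setU1 /=.
- rewrite !inE !addnA eqn_add2r.
  case: (eqVneq w v) => [->|wv]; rewrite ?(negbTE vu) ?(negbTE va) ?(negbTE vb) //.
  case: (eqVneq w u) => [->|wu]; rewrite ?(negbTE ua) ?(negbTE ub) //.
  case: (eqVneq w a) => [->|wa]; rewrite ?(negbTE ab) //.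
- by rewrite !inE (negbTE ubE) !andbF.
- by rewrite !inE (negbTE vaE) !andbF eq_set2 (negbTE vu) (negbTE vb).
Qed.

Lemma nbrs_switch E v u a b : switchable E v u a b ->
  nbrs (switch E v u a b) v = a |: nbrs E v :\ u.
Proof.
case/and5P=> vuE abE vaE ubE; rewrite /= !inE !negb_or -!andbA.
case/and5P=> vu va vb ua /and3P[ub ab _].
apply/setP => x; rewrite !inE !eq_set2 eqxx /= (negbTE vu) (negbTE va) (negbTE vb) /=.
by rewrite ?andbF ?orbF /= ?orbF.
Qed.

(** Of the removed edges, [ab] has no end in [S], and [vu] serves only to dominate [v]. *)
Lemma dominated_switch E S v u a b w : u \in S ->
    a \notin S -> b \notin S -> w \notin S -> w != v ->
  dominated E S w -> dominated (switch E v u a b) S w.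
Proof.
move=> uS aS bS wS wv /dominatedP[y yS yw]; apply/dominatedP; exists y => //.
move: yw; rewrite !inE => ->; rewrite andbT !eq_set2 (negbTE wv) /=.
have neq x z : x \in S -> z \notin S -> (x == z) = false.
  by move=> xS; apply: contraNF => /eqP<-.
rewrite (neq y a) // (neq y b) // ![w == _]eq_sym (neq u w) //.
by rewrite !andbF /= !orbT.
Qed.

End Switch.

(** * Double counting of switchings *)

Section SwitchCount.
Variables (n d : nat) (S W : {set 'I_n}) (v : 'I_n).
Hypotheses (vS : v \notin S) (vW : v \notin W) (WS : W \subset ~: S).

Definition family : {set graph n} :=
  [set E | regular d E && [forall w in W, dominated E S w]].

Definition family_deg (j : nat) : {set graph n} :=
  [set E in family | #|nbrs E v :&: S| == j].

Notation triple := ('I_n * ('I_n * 'I_n))%type.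

(** The arcs [(a, b)] outside [S] for which neither [va] nor [ub] is already an edge. *)
Definition down_pairs (E : graph n) (u : 'I_n) : {set 'I_n * 'I_n} :=
  [set p | [&& p.2 \in nbrs E p.1, p.1 \notin S, p.2 \notin S,
               p.1 \notin v |: nbrs E v & p.2 \notin nbrs E u]].

Definition down (E : graph n) : {set triple} :=
  [set t | (t.1 \in nbrs E v :&: S) && (t.2 \in down_pairs E t.1)].

(** A superset of the triples along which a switching can have led to [E]; as only an upper bound on
    these is wanted, validity of the reverse switching is not demanded. *)
Definition up (E : graph n) : {set triple} :=
  [set t | [&& t.2.1 \in nbrs E v :\: S, t.1 \in S & t.2.2 \in nbrs E t.1]].

(** For each of the [j] choices of [u], discard from the [d * n] arcs those starting or ending in
    [S], those starting in the closed neighbourhood of [v], and those ending in [nbrs E u]. *)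
Lemma card_down E j : regular d E -> #|nbrs E v :&: S| = j ->
  (j * (d * n - (2 * (#|S| * d) + d.+1 * d + d * d)) <= #|down E|)%N.
Proof.
move=> rE <-; rewrite card_dep_pairs -sum_nat_const.
apply: leq_sum => u _; set P := down_pairs E u.
pose out (T : {set 'I_n}) := [set p : 'I_n * 'I_n | (p.1 \in T) && (p.2 \in nbrs E p.1)].
pose into (T : {set 'I_n}) := [set p : 'I_n * 'I_n | (p.2 \in T) && (p.2 \in nbrs E p.1)].
have sub : out [set: 'I_n] \subset
    P :|: (out S :|: (into S :|: (out (v |: nbrs E v) :|: into (nbrs E u)))).
  apply/subsetP => -[a b]; rewrite !in_setU !(in_set, in_setT) /= => -> /=.
  by rewrite !andbT; do ![case: (_ \in _)].
have leU (A B : {set 'I_n * 'I_n}) : (#|A :|: B| <= #|A| + #|B|)%N.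
  by rewrite cardsU leq_subr.
have := subset_leq_card sub; rewrite (card_arcs _ rE) cardsT card_ord.
have := leU P (out S :|: (into S :|: (out (v |: nbrs E v) :|: into (nbrs E u)))).
have := leU (out S) (into S :|: (out (v |: nbrs E v) :|: into (nbrs E u))).
have := leU (into S) (out (v |: nbrs E v) :|: into (nbrs E u)).
have := leU (out (v |: nbrs E v)) (into (nbrs E u)).
rewrite !(card_arcs _ rE) !(card_arcs_to _ rE) cardsU1 (regular_irr v rE) /=.
rewrite !(card_nbrs _ rE) add1n.
set k1 := #|out (v |: _) :|: _|; set k2 := #|into S :|: _|.
set k3 := #|out S :|: _|; set k4 := #|P :|: _|; move: k1 k2 k3 k4 #|P| #|S|.
by move=> k1 k2 k3 k4 p s; rewrite [(n * d)%N]mulnC; lia.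
Qed.

Lemma card_up E j : regular d E -> #|nbrs E v :&: S| = j ->
  #|up E| = ((d - j) * (#|S| * d))%N.
Proof.
move=> rE degv; rewrite -(card_arcs S rE).
have -> : (d - j = #|nbrs E v :\: S|)%N.
  by rewrite -(card_nbrs v rE) -(cardsID S (nbrs E v)) degv addKn.
rewrite -cardsX -(on_card_preimset (f := fun t : triple => (t.2.1, (t.1, t.2.2)))).
  by apply: eq_card => -[u [a b]]; rewrite !inE /= andbA.
apply: onW_bij; exists (fun t : triple => (t.2.1, (t.1, t.2.2))); by case=> ? [].
Qed.

Lemma down_switchable E u a b :
  regular d E -> (u, (a, b)) \in down E -> switchable E v u a b.
Proof.
move=> rE; rewrite inE /= in_setI [(a, b) \in _]inE /= in_setU1 negb_or -!andbA.
case/and4P=> uv uS ba /and5P[aS bS av anv bu].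
have neq x z : x \in S -> z \notin S -> (x == z) = false.
  by move=> xS; apply: contraNF => /eqP<-.
rewrite /switchable -!in_nbrs uv ba anv bu /= !inE !negb_or !(eq_sym v).
rewrite (neq u v) // (neq u a) // (neq u b) // av andbT /=; apply/andP; split.
  by apply: contraNneq bu => ->; rewrite nbrsC.
by apply: contraTneq ba => ->; rewrite (regular_irr _ rE).
Qed.

Lemma switch_down E j u a b : E \in family_deg j.+1 ->
  (u, (a, b)) \in down E ->
  switch E v u a b \in family_deg j /\ (u, (a, b)) \in up (switch E v u a b).
Proof.
rewrite inE inE => /andP[/andP[rE /forall_inP dW] /eqP degv] tE.
have sw := down_switchable rE tE.
move: tE; rewrite inE /= in_setI [(a, b) \in _]inE /= in_setU1 negb_or -!andbA.
case/and4P=> uv uS ba /and5P[aS bS av anv bu].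
split.
  rewrite !in_set regular_switch //= nbrs_switch //; apply/andP; split.
    apply/forall_inP => w wW; apply: dominated_switch => //; last exact: dW.
      by have /subsetP/(_ _ wW) := WS; rewrite inE.
    by apply: contraNneq vW => <-.
  rewrite setIUl (_ : [set a] :&: S = set0); last first.
    by apply/setP => x; rewrite !inE; case: eqVneq => // ->; rewrite (negbTE aS).
  rewrite set0U setIDAC.
  by have := cardsD1 u (nbrs E v :&: S); rewrite degv in_setI uv uS add1n => -[->].
rewrite inE /= nbrs_switch // !inE eqxx /= uS aS /=.
by rewrite eqxx orbT.
Qed.

(** Keeping the triple and switching the graph injects the pairs counted by [down] over degree
    [j.+1] into those counted by [up] over degree [j]. *)
Lemma switch_ratio j :
  (#|family_deg j.+1| *
     (j.+1 * (d * n - (2 * (#|S| * d) + d.+1 * d + d * d)))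
   <= #|family_deg j| * ((d - j) * (#|S| * d)))%N.
Proof.
pose X := [set p : graph n * triple | (p.1 \in family_deg j.+1) && (p.2 \in down p.1)].
pose Y := [set p : graph n * triple | (p.1 \in family_deg j) && (p.2 \in up p.1)].
have leX : (#|family_deg j.+1| *
     (j.+1 * (d * n - (2 * (#|S| * d) + d.+1 * d + d * d))) <= #|X|)%N.
  rewrite card_dep_pairs -sum_nat_const; apply: leq_sum => E.
  by rewrite inE inE => /andP[/andP[rE _] /eqP]; apply: card_down.
have -> : (#|family_deg j| * ((d - j) * (#|S| * d)) = #|Y|)%N.
  rewrite card_dep_pairs -sum_nat_const; apply: eq_bigr => E.
  by rewrite inE inE => /andP[/andP[rE _] /eqP degv]; rewrite (card_up rE degv).
apply: leq_trans leX _.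
pose h (p : graph n * triple) := (switch p.1 v p.2.1 p.2.2.1 p.2.2.2, p.2).
have h_inj : {in X &, injective h}.
  move=> [E [u [a b]]] [E' [u' [a' b']]]; rewrite inE [in X in _ -> X]inE /=.
  move=> /andP[EF tE] /andP[EF' tE'] [eqs eu ea eb]; subst u' a' b'.
  have rE : regular d E by move: EF; rewrite inE inE => /andP[/andP[]].
  have rE' : regular d E' by move: EF'; rewrite inE inE => /andP[/andP[]].
  have := switchK (down_switchable rE tE).
  by rewrite /= eqs (switchK (down_switchable rE' tE')) => ->.
rewrite -(card_in_imset h_inj); apply: subset_leq_card; apply/subsetP => q.
case/imsetP=> -[E [u [a b]]]; rewrite inE /= => /andP[EF tE] ->.
by have [h1 h2] := switch_down EF tE; rewrite inE /= h1.
Qed.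

End SwitchCount.

(** * Proportion of regular graphs dominated by a fixed set *)

Section CountDominated.
Variables (R : realType) (n d : nat) (S : {set 'I_n}) (beta : R).
Hypothesis beta_ge0 : 0 <= beta.
Let L := (d * n - (2 * (#|S| * d) + d.+1 * d + d * d))%N.
Hypothesis L_gt0 : (0 < L)%N.
Hypothesis leL : (#|S| * d)%:R <= beta * L%:R.

(** Successive ratios are at most [beta * (d - j) / (j + 1)], and their product telescopes to a
    binomial coefficient times a power of [beta]. *)
Lemma family_deg_le (W : {set 'I_n}) (v : 'I_n) j :
  v \notin S -> v \notin W -> W \subset ~: S ->
  #|family_deg d S W v j|%:R <=
    'C(d, j)%:R * beta ^+ j * #|family_deg d S W v 0|%:R.
Proof.
move=> vS vW WS; elim: j => [|j IHj]; first by rewrite bin0 expr0 !mul1r.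
have L0 : 0 < L%:R :> R by rewrite ltr0n.
have := switch_ratio d vS vW WS j; rewrite -/L -(ler_nat R) !natrM => le_j.
have {le_j} le_j : #|family_deg d S W v j.+1|%:R * j.+1%:R <=
    #|family_deg d S W v j|%:R * ((d - j)%:R * beta) :> R.
  rewrite -(ler_pM2r L0) -!mulrA; apply: le_trans le_j _.
  by rewrite !ler_wpM2l // -natrM.
rewrite -(ler_pM2r (ltr0Sn R j)); apply: le_trans le_j _.
apply: le_trans (ler_wpM2r _ IHj) _; first by rewrite mulr_ge0.
rewrite le_eqVlt; apply/orP; left; apply/eqP.
transitivity ((d - j)%:R * 'C(d, j)%:R * beta ^+ j.+1 *
              #|family_deg d S W v 0|%:R); first by rewrite exprS; ring.
by rewrite -natrM -mul_bin_left natrM; ring.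
Qed.

(** Summing over the number of neighbours of [v] in [S] gives the binomial expansion of
    [(1 + beta) ^+ d]. *)
Lemma family_le (W : {set 'I_n}) (v : 'I_n) :
  v \notin S -> v \notin W -> W \subset ~: S ->
  #|family d S W|%:R <= (1 + beta) ^+ d * #|family_deg d S W v 0|%:R.
Proof.
move=> vS vW WS.
have -> : #|family d S W| = (\sum_(j < d.+1) #|family_deg d S W v j|)%N.
  pose deg E : 'I_d.+1 := inord #|nbrs E v :&: S|.
  rewrite -sum1_card (partition_big deg xpredT) //=; apply: eq_bigr => j _.
  rewrite sum1_card; apply: eq_card => E; rewrite unfold_in !inE.
  case: (boolP (regular d E)) => //= rE; congr (_ && _).
  rewrite /deg -val_eqE /= inordK // ltnS -(card_nbrs v rE).
  exact: subset_leq_card (subsetIl _ _).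
rewrite natr_sum exprDn mulr_suml; apply: ler_sum => j _.
by rewrite expr1n mul1r -[_ *+ 'C(d, j)]mulr_natl family_deg_le.
Qed.

Let p : R := ((1 + beta) ^+ d)^-1.

(** Requiring [v] to be dominated removes exactly the graphs where [v] has no neighbour in [S], a
    proportion of at least [p]. *)
Lemma family_add (W : {set 'I_n}) (v : 'I_n) :
  v \notin S -> v \notin W -> W \subset ~: S ->
  #|family d S (v |: W)|%:R <= (1 - p) * #|family d S W|%:R.
Proof.
move=> vS vW WS; have := family_le vS vW WS.
have b0 : 0 < (1 + beta) ^+ d by rewrite exprn_gt0 // ltr_wpDr.
rewrite -ler_pdivrMl // -/p => le0.
have : (#|family d S (v |: W)| + #|family_deg d S W v 0| <= #|family d S W|)%N.
  have /setIidPr <- : family_deg d S W v 0 \subset family d S W.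
    by apply/subsetP => E; rewrite [E \in _]inE => /andP[].
  rewrite addnC -(cardsID (family_deg d S W v 0) (family d S W)) leq_add2l.
  apply/subset_leq_card/subsetP => E; rewrite !inE => /andP[rE /forall_inP dW].
  have /dominatedP[u uS uv] := dW v (setU11 _ _).
  have dv : #|nbrs E v :&: S| != 0%N.
    by rewrite -lt0n; apply/card_gt0P; exists u; rewrite inE uv.
  rewrite rE (negbTE dv) !andbF /=.
  by apply/forall_inP => w wW; apply: dW; rewrite setU1r.
rewrite -(ler_nat R) natrD; lra.
Qed.

Lemma card_dominating_le :
  #|[set E : graph n | regular d E && dominating E S]|%:R <=
    (1 - p) ^+ (n - #|S|) * #|[set E : graph n | regular d E]|%:R.
Proof.
have p1 : 0 <= 1 - p.
  by rewrite subr_ge0 invf_le1 ?exprn_gt0 ?exprn_ege1 ?lerDl // ltr_wpDr.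
have seq_le (l : seq 'I_n) : uniq l -> {subset l <= ~: S} ->
    #|family d S [set x in l]|%:R <=
      (1 - p) ^+ size l * #|[set E : graph n | regular d E]|%:R.
  elim: l => [_ _|v l IHl /andP[vl ul] sub].
    rewrite mul1r ler_nat; apply/subset_leq_card/subsetP => E.
    by rewrite !inE => /andP[].
  rewrite /= exprS -mulrA set_cons.
  have subl : {subset l <= ~: S} by move=> x xl; apply: sub; rewrite inE xl orbT.
  apply: le_trans (family_add _ _ _) _; rewrite ?inE //.
  - by have := sub v (mem_head _ _); rewrite inE.
  - by apply/subsetP => x; rewrite inE => /subl.
  - by rewrite ler_wpM2l // IHl.
have sizeC : size (enum (~: S)) = (n - #|S|)%N.
  by rewrite -cardE -[X in (X - _)%N]card_ord -(cardsC S) addKn.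
rewrite -sizeC; apply: le_trans (seq_le _ (enum_uniq _) _); last first.
  by move=> x; rewrite mem_enum.
rewrite ler_nat; apply/subset_leq_card/subsetP => E; rewrite !inE => /andP[-> /=].
by move=> /dominatingP dE; apply/forall_inP => w; rewrite inE mem_enum inE => /dE.
Qed.

End CountDominated.

(** A single term of the expansion of [(1 + x) ^+ n]. *)
Lemma bin_le_pow (R : realType) (n s : nat) (x : R) : 0 < x ->
  'C(n, s)%:R <= (x ^+ s)^-1 * (1 + x) ^+ n.
Proof.
move=> x0; rewrite ler_pdivlMl ?exprn_gt0 // mulrC.
case: (leqP s n) => [sn|ns]; last first.
  by rewrite bin_small // mul0r exprn_ge0 // addr_ge0 // ltW.
rewrite exprDn (bigD1 (Ordinal (n:=n.+1) (m:=s) sn)) //= expr1n mul1r mulr_natl.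
by rewrite lerDl sumr_ge0 // => i _; rewrite expr1n mul1r mulrn_wge0 // exprn_ge0 // ltW.
Qed.

Lemma superset_of_card (T : finType) (A : {set T}) (s : nat) :
  (#|A| <= s <= #|T|)%N -> exists2 B : {set T}, A \subset B & #|B| = s.
Proof.
move=> /andP[leAs sT]; elim: s leAs sT => [|s IHs] leAs sT.
  by exists A => //; apply/eqP; rewrite -leqn0.
move: leAs; rewrite leq_eqVlt ltnS => /predU1P[<-|leAs]; first by exists A.
have [B AB cB] := IHs leAs (ltnW sT).
have /card_gt0P[x] : (0 < #|~: B|)%N by have := cardsC B; rewrite cB; lia.
rewrite inE => xB; exists (x |: B); last by rewrite cardsU1 xB cB.
by apply: subset_trans AB (subsetUr _ _).
Qed.

(** Dominating sets may be enlarged, so the union bound runs over the sets of size exactly [s]. *)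
Lemma card_small_dominating (R : realType) (n d s : nat) (beta : R) :
  let L := (d * n - (2 * (s * d) + d.+1 * d + d * d))%N in
  (s <= n)%N -> 0 <= beta -> (0 < L)%N -> (s * d)%:R <= beta * L%:R ->
  #|[set E : graph n | regular d E &&
       [exists S : {set 'I_n}, (#|S| <= s)%N && dominating E S]]|%:R <=
    'C(n, s)%:R * (1 - ((1 + beta) ^+ d)^-1) ^+ (n - s)
      * #|[set E : graph n | regular d E]|%:R.
Proof.
move=> L sn b0 L0 leL; set B := [set E | _]; set p := (_ ^+ d)^-1.
pose dS (S : {set 'I_n}) : {set graph n} := [set E | regular d E && dominating E S].
have sub : B \subset \bigcup_(S : {set 'I_n} | #|S| == s) dS S.
  apply/subsetP => E; rewrite inE => /andP[rE /existsP[S /andP[Ss dE]]].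
  have [|T ST cT] := @superset_of_card _ S s; first by rewrite Ss card_ord.
  apply/bigcupP; exists T; rewrite ?cT ?inE // rE.
  exact: dominatingS dE.
have leB : (#|B| <= \sum_(S : {set 'I_n} | #|S| == s) #|dS S|)%N.
  apply: leq_trans (subset_leq_card sub) _.
  elim/big_rec2: _ => [|S k A _ le_Ak]; first by rewrite cards0.
  by rewrite cardsU (leq_trans (leq_subr _ _)) // leq_add2l.
apply: le_trans (_ : (\sum_(S : {set 'I_n} | #|S| == s) #|dS S|)%:R <= _).
  by rewrite ler_nat.
rewrite natr_sum -mulrA.
have -> : 'C(n, s) = #|[set S : {set 'I_n} | #|S| == s]| by rewrite card_draws card_ord.
rewrite mulr_natl -sumr_const.
rewrite [X in _ <= X](eq_bigl (fun S : {set 'I_n} => #|S| == s)); last by move=> S; rewrite inE.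
apply: ler_sum => S /eqP cS; rewrite -cS; apply: card_dominating_le => //; rewrite ?cS //.
Qed.

(** * Existence of regular graphs *)

Lemma sum_interval (a b N : nat) :
  (\sum_(x < N) (a <= x < b) = minn N b - minn N a)%N.
Proof.
elim: N => [|N IHN]; first by rewrite big_ord0 !min0n.
rewrite big_ord_recr /= IHN; case: (leqP a N) => aN; case: (leqP b N) => bN /=; lia.
Qed.

(** The graph is a Cayley graph of the cyclic group of order [n], with a symmetric connection set of
    [d] nonzero elements. *)
Lemma exists_regular (d n : nat) : (d < n)%N -> ~~ odd (d * n) ->
  exists E : graph n, regular d E.
Proof.
case: n => // n dn ev; pose T := 'I_n.+1.
pose h := d./2; pose c := n.+1./2.
have dE : d = (odd d + h.*2)%N by rewrite odd_double_half.
have cE : odd d -> n.+1 = c.*2.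
  by move: ev; rewrite oddM negb_and => /orP[/negbTE->//|ev] _; rewrite even_halfK.
(* The residues 1 to [h] and their opposites; when [d] is odd, also the involution [c], which exists
   because the order is then even. *)
pose D := [set x : T | [|| 1 <= x < h.+1, n.+1 - h <= x < n.+1
                         | c <= x < c + odd d]%N].
have D0 : 0 \notin D by rewrite inE /=; case: odd cE dE => /= [/(_ isT)|_]; lia.
have DN (x : T) : x \in D -> - x \in D.
  have [->|x0] := eqVneq x 0; first by rewrite oppr0.
  have x0' : (0 < x)%N by rewrite lt0n; apply: contraNneq x0 => x0; apply/eqP/val_inj.
  have -> : (- x \in D) = [|| 1 <= n.+1 - x < h.+1, n.+1 - h <= n.+1 - x < n.+1
                         | c <= n.+1 - x < c + odd d]%N.
    by rewrite inE /= modn_small //; lia.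
  rewrite inE; have := ltn_ord x.
  by case: odd cE dE => /= [/(_ isT)|_]; lia.
have cardD : #|D| = d.
  rewrite -sum1_card big_mkcond /=.
  rewrite (eq_bigr (fun x : T => (1 <= x < h.+1) + (n.+1 - h <= x < n.+1)
                               + (c <= x < c + odd d)))%N => [|x _].
    rewrite !big_split /= !sum_interval.
    by case: odd cE dE => /= [/(_ isT)|_]; lia.
  rewrite inE; have := ltn_ord x.
  by case: odd cE dE => /= [/(_ isT)|_]; case: (leqP 1 x); case: (leqP h.+1 x);
    case: (leqP (n.+1 - h) x); case: (leqP n.+1 x); case: (leqP c x);
    case: (leqP (c + _) x); rewrite /=; lia.
pose E : graph n.+1 := [set [set v; v + x] | v in T, x in D].
have inE' u v : ([set u; v] \in E) = (v - u \in D).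
  apply/imset2P/idP => [[w x _ xD /eqP]|uvD].
    rewrite eq_set2 => /orP[]/andP[/eqP-> /eqP->]; first by rewrite addrAC subrr add0r.
    by rewrite opprD addrA subrr add0r DN.
  by exists u (v - u); rewrite // addrC subrK.
exists E; apply/andP; split.
  apply/forall_inP => e /imset2P[v x _ xD ->]; rewrite cards2.
  rewrite -{1}[v]addr0 (inj_eq (addrI v)).
  have -> // : 0 != x by apply: contraNneq D0 => ->.
apply/forallP => v; rewrite -[d in _ == d]cardD.
rewrite -(card_imset D (addrI v)) -(card_imset _ (@set2_inj _ v)).
apply/eqP/eq_card => e; rewrite [LHS]inE; apply/andP/imsetP => [[]|[u]].
  case/imset2P => u x _ xD ->; rewrite !inE => /orP[]/eqP->.
    by exists (u + x); rewrite ?imset_f.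
  exists u; last by rewrite setUC.
  by apply/imsetP; exists (- x); rewrite ?DN // addrK.
by case/imsetP=> x xD -> ->; rewrite inE' set21 addrAC subrr add0r.
Qed.

(** * Domination in random regular graphs *)

Lemma tends_alongP (R : realType) (adm : pred nat) (u : nat -> R) (l : R) :
  tends_along adm u l <->
  forall e : R, 0 < e ->
    exists N, forall n, (N <= n)%N -> adm n -> `|l - u n| < e.
Proof.
split=> [/cvgrPdist_lt cu e e0|H].
  have [N _ HN] := cu e e0; exists N => n Nn; exact: HN.
apply/cvgrPdist_lt => e e0; have [N HN] := H e e0.
by exists N => // n /= Nn; apply: HN.
Qed.

Lemma expRN_small (R : realType) (c e : R) : 0 < c -> 0 < e ->
  exists N, forall n, (N <= n)%N -> expR (- (n%:R * c)) < e.
Proof.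
move=> c0 e0; exists (Num.truncn ((e * c)^-1)).+1 => n Nn.
have Nn' : (e * c)^-1 < n%:R.
  by apply: lt_le_trans (truncnS_gt _) _; rewrite ler_nat.
have n0 : 0 < n%:R :> R by apply: lt_trans Nn'; rewrite invr_gt0 mulr_gt0.
rewrite expRN invf_plt ?posrE ?expR_gt0 //.
apply: lt_le_trans (_ : n%:R * c <= _); last by apply: le_trans (expR_ge1Dx _); rewrite lerDr.
by rewrite -ltr_pdivrMr // -invfM.
Qed.

Lemma Pr_random_regular (R : realType) (d n : nat) (A : pred (graph n)) :
  Pr (random_regular R d n) A =
  #|[set E : graph n | regular d E && A E]|%:R / #|[set E : graph n | regular d E]|%:R.
Proof.
rewrite /Pr /random_regular; under eq_bigr do rewrite ffunE.
rewrite -mulr_suml; congr (_ / _); rewrite -natr_sum -sum1_card; congr (_%:R).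
rewrite [LHS]big_mkcond [RHS]big_mkcond; apply: eq_bigr => E _; rewrite !inE.
by case: (regular d E); case: (A E).
Qed.

(** Equality fails when there is no [d]-regular graph, as both probabilities are then 0. *)
Lemma Pr_random_regularC (R : realType) (d n : nat) (A : pred (graph n)) :
  Pr (random_regular R d n) (fun E => ~~ A E) <= 1 - Pr (random_regular R d n) A.
Proof.
rewrite !Pr_random_regular lerBrDr -mulrDl -natrD.
have [->|r0] := posnP #|[set E : graph n | regular d E]|; first by rewrite invr0 mulr0.
rewrite ler_pdivrMr ?ltr0n // mul1r ler_nat addnC.
rewrite -(cardsID [set E | A E] [set E : graph n | regular d E]) leq_add //.
  by apply/subset_leq_card/subsetP => E; rewrite !inE.
by apply/subset_leq_card/subsetP => E; rewrite !inE andbC.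
Qed.

Lemma exponent_le (R : realType) (a b t : R) :
  0 <= t -> a <= 12 / 64 * t -> b <= 8^-1 * t -> a + b - t / 2 <= - (8^-1 * t).
Proof. lra. Qed.

(** At most half of the arcs are discarded when counting switchings. *)
Lemma switch_room (d n s : nat) : (0 < d)%N -> (8 * d + 4 <= n)%N -> (8 * s <= n)%N ->
  let L := (d * n - (2 * (s * d) + d.+1 * d + d * d))%N in
  [/\ (d < n)%N, (s <= n)%N, (0 < L)%N & (d * n <= 2 * L)%N].
Proof.
move=> d0 dn sn; have dn0 : (0 < d * n)%N by rewrite muln_gt0 d0; lia.
have : (2 * (2 * (s * d) + d.+1 * d + d * d) <= d * n)%N.
  have -> : (2 * (2 * (s * d) + d.+1 * d + d * d) = d * (4 * s + 4 * d + 2))%N by lia.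
  by rewrite leq_mul2l; apply/orP; right; lia.
by split; lia.
Qed.

(** * First moment bound on small dominating sets *)

Section FirstMoment.
Variables (R : realType) (d : nat).
Hypothesis d3 : (3 <= d)%N.
Let alpha : R := 256^-1 * (ln d%:R / d%:R).
(** The fourth root of [d]: since [ln d = 4 ln y <= 4 y], logarithms can be traded for powers of
    [y]. *)
Let y : R := Num.sqrt (Num.sqrt d%:R).

Let d_gt0 : (0 < d)%N. Proof. exact: leq_trans d3. Qed.
Let d0 : 0 < d%:R :> R. Proof. by rewrite ltr0n. Qed.
Let d1 : 1 <= d%:R :> R. Proof. by rewrite ler1n. Qed.
Let y1 : 1 <= y.
Proof.
have s1 : 1 <= Num.sqrt d%:R :> R.
  by rewrite -[X in X <= _]sqrtr1 ler_wsqrtr.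
by rewrite -[X in X <= _]sqrtr1 ler_wsqrtr.
Qed.
Let y4 : d%:R = y ^+ 4 :> R.
Proof. by rewrite (exprM y 2 2) !sqr_sqrtr ?sqrtr_ge0. Qed.
Let y0 : 0 < y. Proof. exact: lt_le_trans ltr01 y1. Qed.
Let lnd : ln d%:R = ln y *+ 4 :> R. Proof. by rewrite y4 lnXn. Qed.
Let lny : 0 <= ln y <= y. Proof. by rewrite ln_ge0 // ltW // ln_sublinear. Qed.
Let alpha_ge0 : 0 <= alpha.
Proof. by rewrite /alpha lnd !mulr_ge0 ?invr_ge0 ?mulrn_wge0 //; case/andP: lny. Qed.
Let alphad : alpha * d%:R = 256^-1 * (ln y *+ 4).
Proof. by rewrite /alpha -lnd -mulrA divfK // gt_eqF. Qed.
Let alpha_le : alpha <= 1 / 8.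
Proof.
rewrite -(ler_pM2r d0) alphad.
have : y <= y ^+ 4 by rewrite ler_eXnr.
by rewrite -y4; case/andP: lny; lra.
Qed.

Let p : R := ((1 + 2 * alpha) ^+ d)^-1.

(** [(1 + 2 alpha)^d] is at most [expR (2 * alpha * d)], which is [y] to the power 1/32. *)
Let p_ge : (y ^+ 2)^-1 <= p.
Proof.
rewrite lef_pV2 ?posrE ?exprn_gt0 //; last by have := alpha_ge0; lra.
apply: le_trans (_ : expR (2 * alpha) ^+ d <= _).
  rewrite lerXn2r ?nnegrE ?expR_ge0 ?expR_ge1Dx //; have := alpha_ge0; lra.
rewrite -expRM_natr -[y ^+ 2]lnK ?posrE ?exprn_gt0 // ler_expR lnXn // -mulrA alphad.
by case/andP: lny; lra.
Qed.

(** With [q = d^(-1/2)], the logarithm of the binomial coefficient is at most [(12/64 + 1/8) n q],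
    while the other factor contributes [- n q / 2]. *)
Lemma first_moment_le n (s := Num.truncn (alpha * n%:R)) :
  'C(n, s)%:R * (1 - p) ^+ (n - s) <= expR (- (n%:R * (8 * y ^+ 2)^-1)).
Proof.
have n0 : 0 <= n%:R :> R by [].
have s_le : s%:R <= alpha * n%:R by rewrite truncn_le mulr_ge0.
have sn : (s <= n)%N.
  by rewrite -(ler_nat R); apply: le_trans s_le _; rewrite ler_piMl //; have := alpha_le; lra.
have dV0 : 0 < (8 * d%:R)^-1 :> R by rewrite invr_gt0 mulr_gt0.
have q0 : 0 < (y ^+ 2)^-1 by rewrite invr_gt0 exprn_gt0.
have d8 : 0 < 8 * d%:R :> R by rewrite mulr_gt0.
(* [bin_le_pow] at [x = 1/(8d)], small enough for the term [n x] to stay below [n q / 8]. *)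
have bin_le : 'C(n, s)%:R <= expR (s%:R * ln (8 * d%:R) + n%:R * (8 * d%:R)^-1) :> R.
  apply: le_trans (bin_le_pow _ _ dV0) _; rewrite -exprVn invrK expRD.
  apply: ler_pM; [exact/exprn_ge0/ltW|by rewrite exprn_ge0 // addr_ge0 // ltW| |].
    by rewrite [s%:R * _]mulrC expRM_natr lnK ?posrE.
  rewrite [n%:R * _]mulrC expRM_natr lerXn2r ?nnegrE ?expR_ge0 ?expR_ge1Dx //.
  by rewrite addr_ge0 // ltW.
have p1 : p <= 1.
  by rewrite invf_le1 ?exprn_gt0 ?exprn_ege1 //; have := alpha_ge0; lra.
(* Uses [1 - p <= expR (- p)], [p_ge], and [n - s >= n/2], the last from [alpha <= 1/8]. *)
have pow_le : (1 - p) ^+ (n - s) <= expR (- (n%:R * (y ^+ 2)^-1 / 2)).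
  apply: le_trans (_ : expR (- p) ^+ (n - s) <= _).
    by rewrite lerXn2r ?nnegrE ?expR_ge0 ?expR_ge1Dx // subr_ge0.
  rewrite -expRM_natr ler_expR mulNr lerN2 natrB //.
  apply: le_trans (_ : (y ^+ 2)^-1 * (n%:R / 2) <= _); first by lra.
  apply: ler_pM => //; [exact: ltW|exact: divr_ge0|].
  have : alpha * n%:R <= 1 / 8 * n%:R by rewrite ler_wpM2r.
  by lra.
apply: le_trans (ler_pM _ _ bin_le pow_le) _; rewrite ?exprn_ge0 ?subr_ge0 //.
rewrite -expRD ler_expR.
set q := (y ^+ 2)^-1 in q0 *.
have yq : y * y * q = 1 by rewrite -expr2 divff // gt_eqF // exprn_gt0.
have dq : d%:R^-1 = q * q :> R by rewrite y4 (exprM y 2 2) expr2 invfM.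
have q1 : q <= 1 by rewrite invf_le1 ?exprn_gt0 // exprn_ege1.
have alphaq : alpha <= y / 64 * (q * q).
  rewrite -dq ler_pdivlMr // alphad; case/andP: lny; lra.
have ln8d : ln (8 * d%:R) <= 12 * y :> R.
  rewrite lnM ?posrE // lnd.
  have : ln 8 <= 8 :> R by rewrite ltW // ln_sublinear.
  by case/andP: lny => _; have := y1; lra.
have le1 : s%:R * ln (8 * d%:R) <= n%:R * (12 / 64 * q).
  apply: le_trans (_ : (y / 64 * (q * q) * n%:R) * (12 * y) <= _); last first.
    have -> : y / 64 * (q * q) * n%:R * (12 * y) = n%:R * (12 / 64 * (y * y * q * q)).
      by field.
    by rewrite yq mul1r.
  apply: ler_pM => //.
    by apply/ln_ge0/(le_trans d1); rewrite ler_peMl ?ler1n // ltW.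
  by apply: le_trans s_le _; rewrite ler_wpM2r.
have le2 : n%:R * (8 * d%:R)^-1 <= n%:R * (8^-1 * q).
  rewrite ler_wpM2l // invfM dq ler_wpM2l ?invr_ge0 //.
  by rewrite -[X in _ <= X]mulr1 ler_wpM2l // ltW.
have nq : 0 <= n%:R * q by rewrite mulr_ge0 // ltW.
rewrite [(8 * y ^+ 2)^-1]invfM -/q [n%:R * (8^-1 * q)]mulrCA.
by apply: exponent_le nq _ _; rewrite mulrCA.
Qed.

Lemma whp_dom_ratio :
  whp R d (fun n (E : graph n) =>
    256^-1 * (ln d%:R / d%:R) <= dom_ratio R E <= 5 * (ln d%:R / d%:R)).
Proof.
rewrite -/alpha; apply/tends_alongP => e e0.
have c0 : 0 < (8 * y ^+ 2)^-1 by rewrite invr_gt0 mulr_gt0 // exprn_gt0.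
have [N HN] := expRN_small c0 e0.
exists (maxn N (8 * d + 4)) => n; rewrite geq_max => /andP[/HN small dn] ev.
pose s := Num.truncn (alpha * n%:R).
have s_le : s%:R <= alpha * n%:R by rewrite truncn_le mulr_ge0.
have sn : (8 * s <= n)%N.
  rewrite -(ler_nat R) natrM -ler_pdivlMl //; apply: le_trans s_le _.
  by rewrite ler_wpM2r // -div1r.
have [dn' sn' L0 LL] := switch_room d_gt0 dn sn.
have n0 := leq_ltn_trans (leq0n _) dn'.
(* Without a regular graph, [random_regular] would be the zero function and the limit 1 would
   fail. *)
have [E0 rE0] := exists_regular dn' ev.
set reg := [set E : graph n | regular d E].
have r0 : 0 < #|reg|%:R :> R by rewrite ltr0n; apply/card_gt0P; exists E0; rewrite inE.
rewrite Pr_random_regular -/reg; set good := [set E | _].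
(* The upper bound holds for every regular graph, so only the lower one can fail. *)
have badP : reg :\: good \subset [set E : graph n | regular d E &&
    [exists S : {set 'I_n}, (#|S| <= s)%N && dominating E S]].
  apply/subsetP => E; rewrite !inE => /andP[nE rE]; rewrite rE /=.
  move: nE; rewrite rE dom_ratio_le_ln ?(ltnW dn') ?andbT //=.
  have [S dS ->] := dom_ratio_ex R E; rewrite -ltNge ltr_pdivrMr ?ltr0n // => lt_S.
  by apply/existsP; exists S; rewrite dS andbT truncn_ge_nat; [exact: ltW|exact: mulr_ge0].
have bad_le : #|reg :\: good|%:R <= expR (- (n%:R * (8 * y ^+ 2)^-1)) * #|reg|%:R.
  apply: le_trans (_ : #|[set E : graph n | regular d E &&
    [exists S : {set 'I_n}, (#|S| <= s)%N && dominating E S]]|%:R <= _).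
    by rewrite ler_nat subset_leq_card.
  (* The factor 2 pays for the arcs lost in counting switchings, as [d * n <= 2 * L]. *)
  apply: le_trans (card_small_dominating (beta := 2 * alpha) _ _ _ _) _.
  - by [].
  - by rewrite mulr_ge0.
  - by [].
  - rewrite [2 * _]mulrC -mulrA natrM.
    apply: le_trans (_ : alpha * (d * n)%:R <= _).
      by rewrite natrM mulrCA [s%:R * _]mulrC ler_wpM2l.
    by rewrite ler_wpM2l // -(natrM _ 2) ler_nat.
  - by rewrite ler_wpM2r // first_moment_le.
have -> : #|good|%:R = #|reg|%:R - #|reg :\: good|%:R :> R.
  have /setIidPr reg_good : good \subset reg by apply/subsetP => E; rewrite !inE => /andP[].
  by rewrite -(cardsID good reg) reg_good natrD addrK.
rewrite mulrBl divff ?gt_eqF // opprB addrC subrK ger0_norm ?divr_ge0 //.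
by apply: le_lt_trans small; rewrite ler_pdivrMr.
Qed.

End FirstMoment.

(** * Machines *)

Section FilterMachine.
Variables (M : machine) (A : finType) (a0 : A) (next : A -> bool -> A) (acc : A -> bool).

(** Output bits of [M] are fed to the automaton instead of being written. When [M] halts, one extra
    step writes the verdict and enters the halting state [None]. *)
Definition filter_delta (s : option (state M * A)) (c : option (bool + aux M)) :
    option (option (state M * A) * option (bool + aux M) * move * option bool) :=
  if s is Some (q, a) then
    if delta q c is Some (q', c', mv, o) then
      Some (Some (q', if o is Some b then next a b else a), c', mv, None)
    else Some (None, c, Stay, if acc a then Some true else None)
  else None.

Definition filter_machine : machine := Machine (Some (start M, a0)) filter_delta.

Lemma run_filter t q l r w w' :
  run t (q, l, r, w) = Some w' ->
  run t.+1 ((Some (q, foldl next a0 w), l, r, [::]) : config filter_machine) =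
    Some (if acc (foldl next a0 w') then [:: true] else [::]).
Proof.
elim: t q l r w => [|t IHt] q l r w /=.
  by case: (delta q (head None r)) => [[[[q' a] mv] o]|] // [<-]; case: acc.
case: (delta q (head None r)) => [[[[q' a] mv] o]|]; last by move=> [<-]; case: acc.
have -> : (if o is Some b then next (foldl next a0 w) b else foldl next a0 w) =
          foldl next a0 (if o is Some b then rcons w b else w).
  by case: o => // b; rewrite foldl_rcons.
by case: mv => /IHt.
Qed.

End FilterMachine.

Lemma run_leq (M : machine) t t' (c : config M) w :
  (t <= t')%N -> run t c = Some w -> run t' c = Some w.
Proof.
elim: t t' c => [|t IHt] [|t'] c //=; case: (step c) => // c' tt'; exact: IHt.
Qed.

Lemma polytime_filter (f : seq bool -> seq bool) (A : finType) (a0 : A)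
    (next : A -> bool -> A) (acc : A -> bool) :
  polytime f ->
  polytime (fun x => if acc (foldl next a0 (f x)) then [:: true] else [::]).
Proof.
move=> [M [c [e Mf]]]; exists (filter_machine M a0 next acc), c.+1, e => x.
apply: run_leq (run_filter a0 next acc (Mf x)).
by rewrite mulSn; lia.
Qed.

(** * Comparison with a rational threshold by a finite automaton *)

Section Threshold.
Variables p r : nat.
Hypotheses (p_gt0 : (0 < p)%N) (r_gt0 : (0 < r)%N).

(* Sign, pending numerator digit, carry of r * numer - p * denom shifted by p
   so as to be nonnegative, and whether some denominator digit was nonzero.
   [None] is the state before the sign. *)
Definition cmp_state : finType := option (bool * option bool * 'I_(p + r).+1 * bool).

(** The carry [c] becomes the floor of [(c + r a - p b) / 2]; in terms of [k = c + p] the numerator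
    is [k + r a + p (1 - b)]. The bound [k <= p + r] is preserved, so [inord] is faithful. *)
Definition cmp_next (s : cmp_state) (b : bool) : cmp_state :=
  match s with
  | None => Some (b, None, inord p, false)
  | Some (neg, None, k, nz) => Some (neg, Some b, k, nz)
  | Some (neg, Some a, k, nz) =>
      Some (neg, None, inord (k + r * a + p * ~~ b)./2, nz || b)
  end.

(** A negative sign gives a value at most 0, and the empty word or a zero denominator gives 0; all
    lie below the positive threshold. *)
Definition cmp_acc (s : cmp_state) : bool :=
  if s is Some (neg, _, k, nz) then [|| neg, ~~ nz | (k < p)%N] else true.

(** The digits still to be read contribute an even amount, so rounding the halved carry down does
    not affect the final strict comparison. An unpaired last bit stays in [o] and counts for
    nothing. *)
Lemma foldl_cmp neg k nz w :
  exists o k' nz', [/\ foldl cmp_next (Some (neg, None, k, nz)) w = Some (neg, o, k', nz'),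
    nz' = nz || (denom w != 0%N) &
    (k' < p)%N = (k + r * numer w < p + p * denom w)%N].
Proof.
move: {2}(size w) (leqnn (size w)) => m.
elim: m w k nz => [|m IHm] [|a [|b w]] k nz //= sz;
  try by exists None, k, nz; rewrite !muln0 !addn0 orbF.
- by exists (Some a), k, nz; rewrite !muln0 !addn0 orbF.
have [] := IHm w (inord (k + r * a + p * ~~ b)./2) (nz || b) _; first by lia.
move=> o [k' [nz' [-> nzE kE]]]; exists o, k', nz'.
split=> //; first by rewrite nzE; case: (b); case: (nz) => //=; lia.
rewrite {}kE inordK {nzE}.
  by case: a; case: b => /=; rewrite ?muln1 ?muln0 ?addn0; nia.
by have := ltn_ord k; case: a; case: b => /=; lia.
Qed.

Lemma cmp_accE w :
  cmp_acc (foldl cmp_next None w) = (rat_of_word w < p%:R / r%:R).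
Proof.
have q0 : 0 < p%:R / r%:R :> rat by rewrite divr_gt0 ?ltr0n.
case: w => [|s w] /=; first by rewrite q0.
have [o [k [nz [-> -> /=]]]] := foldl_cmp s (inord p) false w.
rewrite inordK ?ltnS ?leq_addr // ltn_add2l => ->.
case: s => /=.
  rewrite expr1 mulN1r; apply/esym/(le_lt_trans _ q0).
  by rewrite oppr_le0 divr_ge0.
rewrite negbK expr0 mul1r; case: eqVneq => [->|d0] /=; first by rewrite invr0 mulr0 q0.
by rewrite ltr_pdivrMr ?ltr0n ?lt0n // mulrAC ltr_pdivlMr ?ltr0n // -!natrM ltr_nat mulnC.
Qed.

End Threshold.

(** * Lifts of the complete graph *)

(** The bordered matrix [B] is made block triangular in two ways, by a left and by a right
    multiplication; the factor [a] avoids division. *)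
Lemma det_scalar_sub_const (R : idomainType) (n : nat) (a : R) : a != 0 ->
  a * \det (a%:M - const_mx 1 : 'M_n) = (a - n%:R) * a ^+ n.
Proof.
move=> a0; pose u : 'cV[R]_n := const_mx 1; pose v : 'rV[R]_n := const_mx 1.
have uv : u *m v = const_mx 1.
  by apply/matrixP => i j; rewrite !mxE big_ord1 !mxE mulr1.
have vu : v *m u = n%:R%:M.
  apply/matrixP => i j; rewrite !mxE (eq_bigr (fun=> 1)) => [|k _]; last by rewrite !mxE mulr1.
  by rewrite sumr_const card_ord !ord1 eqxx mulr1n.
pose B := block_mx 1%:M v u a%:M : 'M_(1 + n).
have detB : \det B = \det (a%:M - const_mx 1 : 'M_n).
  have : \det (block_mx 1%:M 0 (- u) 1%:M *m B) = \det (a%:M - const_mx 1 : 'M_n).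
    rewrite mulmx_block !mul1mx !mul0mx !addr0 mulmx1 addNr det_ublock det1 mul1r.
    by rewrite mulNmx uv addrC.
  by rewrite det_mulmx det_lblock !det1 !mul1r.
have : \det (B *m block_mx a%:M 0 (- u) 1%:M) = (a - n%:R) * a ^+ n.
  rewrite mulmx_block !mul1mx !mulmx0 !add0r !mulmx1 mulmxN vu.
  rewrite mulmxN mul_mx_scalar mul_scalar_mx subrr -raddfB det_ublock.
  by rewrite !det_scalar expr1.
by rewrite det_mulmx det_lblock det1 det_scalar expr1 mulr1 detB mulrC.
Qed.

Definition complete_mx (d : nat) : 'M[nat]_d.+1 := \matrix_(i, j) (i != j : nat).

Lemma complete_regular d : regular_multigraph (complete_mx d) d.
Proof.
split=> [i j|i]; first by rewrite !mxE eq_sym.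
under eq_bigr do rewrite mxE.
transitivity #|predC1 i|; last by rewrite cardC1 card_ord.
rewrite -sum1_card [RHS]big_mkcond; apply: eq_bigr => j _.
by rewrite !inE eq_sym; case: eqP.
Qed.

(** The characteristic matrix is [('X + 1)%:M] minus the all-ones matrix, so the previous
    determinant applies after multiplying by ['X + 1]. *)
Lemma complete_spectrum (R : realType) d :
  spectrum (complete_mx d) (d%:R :: nseq d (-1) : seq R).
Proof.
split.
  rewrite /= ; case: d => // d /=; apply/andP; split.
    by apply: le_trans (ler0n _ _); rewrite oppr_le0.
  by elim: d => //= d ->; rewrite lexx.
have X1 : 'X + 1 != 0 :> {poly R} by rewrite -polyC1 -size_poly_eq0 size_XaddC.
apply: (mulfI X1); rewrite big_cons big_nseq iter_mulr_1.
have -> : char_poly (map_mx (fun a : nat => a%:R : R) (complete_mx d)) =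
          \det (('X + 1)%:M - const_mx 1 : 'M[{poly R}]_d.+1).
  congr (\det _); apply/matrixP => i j; rewrite !mxE.
  by case: eqVneq => _; rewrite ?mulr1n ?mulr0n ?polyC0 ?polyC1; ring.
rewrite det_scalar_sub_const // polyCN polyC1 opprK exprS -polyC_natr.
by rewrite mulrCA -natr1 polyCD polyC1; ring.
Qed.

Lemma complete_ramanujan (R : realType) d : (3 <= d)%N ->
  ramanujan (complete_mx d) R d.
Proof.
move=> d3; split; first by lia.
exists (d%:R :: nseq d (-1)); split; first exact: complete_spectrum.
case: d d3 => // d d3; rewrite [nth _ _ 1]/=.
have -> : (d.+1%:R :: nseq d.+1 (-1))`_d.+2.-1 = -1 :> R.
  by rewrite [LHS](nth_nseq 0 d.+1 (-1 : R) d) ltnSn.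
rewrite normrN normr1 maxxx.
have s1 : 1 <= Num.sqrt (d.+1%:R - 1) :> R.
  rewrite -[X in X <= _]sqrtr1 ler_wsqrtr // lerBrDr -natr1 lerD2r ler1n; lia.
by lra.
Qed.

Section Lift.
Variables (d m : nat) (w : lift_sample d.+1 m d).
Hypotheses (d_gt0 : (0 < d)%N) (wP : w \in lifts (complete_mx d) d m).
Notation n := (d.+1 * m)%N.

Definition base_fiber : {set 'I_n} := [set u | fiber w u == ord0].

Lemma lift_bij : bijective w.1.
Proof.
apply: inj_card_bij; last by rewrite card_prod !card_ord.
by move: wP; rewrite inE => /and3P[/injectiveP].
Qed.

Lemma card_base_fiber : #|base_fiber| = m.
Proof.
have -> : base_fiber = w.1 @^-1: setX [set ord0] [set: 'I_m].
  by apply/setP => u; rewrite !inE andbT.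
by rewrite on_card_preimset ?cardsX ?cards1 ?cardsT ?card_ord ?mul1n //;
  apply/onW_bij/lift_bij.
Qed.

(** In the complete graph every other fiber is matched to fiber 0, so [v] has a partner there. *)
Lemma base_fiber_dominating v : v \notin base_fiber ->
  exists2 u, u \in base_fiber & [set u; v] \in lift_graph (complete_mx d) w.
Proof.
rewrite inE /fiber => v0; have [g gK wK] := lift_bij.
pose c : 'I_d := Ordinal d_gt0; pose pi := w.2 (ord0, (w.1 v).1, c).
exists (g (ord0, (pi^-1)%g (w.1 v).2)); first by rewrite inE /fiber wK.
rewrite inE; apply/existsP; exists (g (ord0, (pi^-1)%g (w.1 v).2)).
apply/existsP; exists v; rewrite eqxx /=; apply/existsP; exists c.
rewrite /lift_arc wK; move: v0; rewrite /pi; case: (w.1 v) => j b /= j0.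
by rewrite mxE eq_sym j0 /= permKV.
Qed.

Lemma dom_ratio_lift (R : realType) (eps : R) (E : graph n) : (0 < m)%N ->
  edge_dist R (lift_graph (complete_mx d) w) E <= eps ->
  dom_ratio R E <= 1 / d.+1%:R + 2 * eps.
Proof.
move=> m0; set G := lift_graph _ _ => close.
have n0 : 0 < n%:R :> R by rewrite ltr0n muln_gt0.
set X := undominated E base_fiber.
have cX : (#|X| <= #|G :\: E|)%N.
  (* Each vertex of [X] is charged to a deleted edge towards the base fiber; [h] recovers it as the
     end outside that fiber. *)
  pose h (e : {set 'I_n}) := [pick v in e | v \notin base_fiber].
  rewrite -(card_imset X (@Some_inj _)); apply: leq_trans (leq_imset_card h _).
  apply/subset_leq_card/subsetP => _ /imsetP[v vX ->]; apply/imsetP.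
  move: vX; rewrite inE => /andP[vF vE].
  have [u uF uv] := base_fiber_dominating vF.
  exists [set u; v].
    rewrite inE uv andbT; apply: contra vE => uvE; apply/dominatedP.
    by exists u => //; rewrite in_nbrs setUC.
  rewrite /h; case: pickP => [x|/(_ v)]; last by rewrite set22 vF.
  by rewrite in_set2 => /andP[/orP[]/eqP-> //]; rewrite uF.
apply: le_trans (dom_ratio_le R (dominating_undominated E base_fiber)) _.
rewrite -/X ler_pdivrMr //.
have c1 : (#|base_fiber :|: X| <= m + #|G :\: E|)%N.
  by rewrite cardsU card_base_fiber (leq_trans (leq_subr _ _)) // leq_add2l.
apply: le_trans (_ : (m + #|G :\: E|)%:R <= _); first by rewrite ler_nat.
rewrite natrD mulrDl lerD //.
  by rewrite natrM mulrA mul1r mulVf ?mul1r // pnatr_eq0.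
apply: le_trans (_ : #|(G :\: E) :|: (E :\: G)|%:R <= _).
  by rewrite ler_nat subset_leq_card // subsetUl.
move: close; rewrite /edge_dist ler_pdivrMr ?mulr_gt0 //.
by rewrite -/G mulrA [eps * 2]mulrC.
Qed.

End Lift.

(** * From certification to detection *)

Lemma rat_between (R : realType) (x eps : R) : 0 <= x -> 0 < eps ->
  exists p r : nat, [/\ (0 < p)%N, (0 < r)%N, x < p%:R / r%:R
                      & p%:R / r%:R <= x + eps].
Proof.
move=> x0 e0; pose r := (Num.truncn eps^-1).+1.
have r0 : 0 < r%:R :> R by rewrite ltr0n.
have re : 1 <= r%:R * eps.
  by rewrite -ler_pdivrMr // div1r ltW // truncnS_gt.
exists (Num.truncn (x * r%:R)).+1, r; split=> //.
  by rewrite ltr_pdivlMr // truncnS_gt.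
rewrite ler_pdivrMr // mulrDl -natr1; apply: lerD.
  by rewrite truncn_le mulr_ge0 // ltW.
by rewrite mulrC.
Qed.

Lemma le_Pr_random_regular (R : realType) (d n : nat) (A B : pred (graph n)) :
  (forall E, A E -> B E) ->
  Pr (random_regular R d n) A <= Pr (random_regular R d n) B.
Proof.
move=> AB; rewrite !Pr_random_regular ler_wpM2r ?invr_ge0 // ler_nat.
by apply/subset_leq_card/subsetP => E; rewrite !inE => /andP[-> /AB].
Qed.

Lemma Pr_noisy_lift0 (R : realType) (k d m : nat) (M : 'M[nat]_k) (K : noise R k d)
    (A : pred (graph (k * m))) :
  (forall w E, w \in lifts M d m -> K m w E != 0 -> ~~ A E) ->
  Pr (noisy_lift M K m) A = 0.
Proof.
move=> H; rewrite /Pr big1 // => E AE; rewrite ffunE big1 // => w _.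
rewrite ffunE; have [wL|] := boolP (w \in _); last by rewrite !mul0r.
have [->|K0] := eqVneq (K m w E) 0; first by rewrite mulr0.
by have := H w E wL K0; rewrite AE.
Qed.

Lemma no_certification (R : realType) (d : nat) (eps : R) :
  (3 <= d)%N -> conjecture_L R -> 0 < eps ->
  ~ exists2 alg : seq bool -> seq bool, polytime alg &
      certifies_whp d (fun n (E : graph n) => dom_ratio R E) (1 / d.+1%:R + eps) alg.
Proof.
move=> d3 conjL e0 [alg alg_poly [cert cert_whp]].
have d_gt0 : (0 < d)%N by apply: leq_trans d3.
(* The noise rate must be below 1, and noise raises the ratio by at most [2 * eps'], to be kept
   within [eps / 2]. *)
pose eps' : R := Num.min 2^-1 (eps / 4).
have eps'01 : 0 < eps' < 1.
  by rewrite lt_min gt_min invr_gt0 divr_gt0 ?ltr0n // invf_lt1 ?ltr1n.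
have eps'_le : 2 * eps' <= eps / 2.
  have : eps' <= eps / 4 by rewrite ge_min lexx orbT.
  by lra.
have [p [r [p0 r0 lt_q q_le]]] := @rat_between R (1 / d.+1%:R + eps / 2) (eps / 2)
  ltac:(by rewrite addr_ge0 ?divr_ge0 ?ltW) ltac:(by rewrite divr_gt0).
rewrite -addrA -splitr in q_le.
have ratr_q : ratr (p%:R / r%:R) = p%:R / r%:R :> R.
  by rewrite fmorph_div /= !ratr_nat.
pose f x := if cmp_acc (foldl (@cmp_next p r) None (alg x)) then [:: true] else [::].
have fE x : (f x == [:: true]) = (rat_of_word (alg x) < p%:R / r%:R).
  by rewrite /f -cmp_accE //; case: cmp_acc.
have f_poly : polytime f by apply: polytime_filter.
(* The adversary [K] is not ours to choose, but the domination bound on noisy lifts holds against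
   any adversary. *)
have [/(_ (complete_ramanujan R d3)) [_ _ [K K_adv K_hard] _] _] :=
  conjL d d.+1 (complete_mx d) eps' d3 (complete_regular d) eps'01.
apply: (K_hard f f_poly); split; apply/tends_alongP => e e_gt0.
  (* On noisy lifts the certified bound is always below the threshold, so this error is exactly
     0. *)
  exists 1%N => m m_gt0 _.
  rewrite Pr_noisy_lift0 ?subrr ?normr0 // => w E wL KE.
  have [_ /(_ E KE) [rE closeE]] := K_adv m w wL.
  rewrite negbK fE -(ltr_rat R) ratr_q.
  apply: le_lt_trans (cert _ _ _ rE) _; first by rewrite muln_gt0.
  apply: le_lt_trans (dom_ratio_lift d_gt0 wL m_gt0 closeE) _.
  by apply: le_lt_trans lt_q; rewrite lerD2l.
(* On random regular graphs, an error forces the certified bound below [1 / d.+1%:R + eps]. Every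
   [m] is admissible for [whp], because [d * d.+1] is even. *)
have /tends_alongP/(_ e e_gt0)[N HN] := cert_whp.
exists N => m Nm _; rewrite sub0r normrN.
have := HN (d.+1 * m)%N; set A := (fun E => _ <= _) => HA.
rewrite ger0_norm; last by rewrite Pr_random_regular divr_ge0.
apply: le_lt_trans (le_Pr_random_regular (B := fun E => ~~ A E) _ _ _) _.
  move=> E; rewrite fE -(ltr_rat R) ratr_q /A -ltNge => /lt_le_trans; exact.
apply: le_lt_trans (Pr_random_regularC _ _ _) _.
apply: le_lt_trans (ler_norm _) (HA _ _).
  by apply: leq_trans Nm _; rewrite leq_pmull.
by rewrite mulnA oddM oddM /= andbN.
Qed.

Theorem theorem1p16 (R : realType) :
  exists C1 C2 : R, [/\ 0 < C1, 0 < C2 &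
    forall d : nat, (3 <= d)%N ->
      [/\ whp R d (fun n (E : graph n) =>
            C1 * (ln d%:R / d%:R) <= dom_ratio R E <= C2 * (ln d%:R / d%:R)),
          forall (n : nat) (E : graph n), (0 < n)%N -> regular d E ->
            1 / (d.+1)%:R <= dom_ratio R E
        & conjecture_L R -> forall eps : R, 0 < eps ->
            ~ exists2 alg : seq bool -> seq bool, polytime alg &
                certifies_whp d (fun n (E : graph n) => dom_ratio R E)
                  (1 / (d.+1)%:R + eps) alg]].
Proof.
exists 256^-1, 5; split=> [||d d3]; rewrite ?invr_gt0 //; split.
- exact: whp_dom_ratio.
- by move=> n E n0 rE; apply: dom_ratio_ge.
- by move=> conjL eps; apply: no_certification.
Qed.
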